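(* Let $1\le m\le n$, let $E_1,\dots,E_m,F$ be Banach spaces over $\mathbb{K}$, and let $q_1,\dots,q_m\in[1,\infty)$. If $$\mathcal{L}(E_1,\dots,E_m;F)=\mathcal{L}_{as(1;q_1,\dots,q_m)}(E_1,\dots,E_m;F),$$ then, for any Banach spaces $E_{m+1},\dots,E_n$ over $\mathbb{K}$, $$\mathcal{L}(E_1,\dots,E_n;F)=\mathcal{L}_{as(1;q_1,\dots,q_m,1,\dots,1)}(E_1,\dots,E_n;F),$$ where the index $1$ after $q_m$ is repeated $n-m$ times.
   Context: The scalar field $\mathbb{K}$ is $\mathbb{R}$ or $\mathbb{C}$. $\mathcal{L}(E_1,\dots,E_n;F)$ is the space of bounded $n$-linear mappings $E_1\times\dots\times E_n\to F$. For $p\ge1$, $l_p(E)$ is the space of sequences $(x_j)$ in $E$ with $\sum_j\|x_j\|^p<\infty$, and $l_p^w(E)$ is the space of sequences $(x_j)$ in $E$ with $(\varphi(x_j))_j\in l_p$ for every bounded linear functional $\varphi$ on $E$. A mapping $T\in\mathcal{L}(E_1,\dots,E_n;F)$ is absolutely $(p;q_1,\dots,q_n)$-summing if $(T(x_j^{(1)},\dots,x_j^{(n)}))_{j=1}^\infty\in l_p(F)$ whenever $(x_j^{(i)})_{j=1}^\infty\in l_{q_i}^w(E_i)$ for $i=1,\dots,n$; the space of all such mappings is denoted $\mathcal{L}_{as(p;q_1,\dots,q_n)}(E_1,\dots,E_n;F)$. *)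

(* Defs.v *)
From HB Require Import structures.
From mathcomp Require Export all_boot all_order all_algebra complex.
From mathcomp Require Export boolp classical_sets reals constructive_ereal ereal.
From mathcomp Require Export topology normedtype sequences exp.

Set Implicit Arguments.
Unset Strict Implicit.
Unset Printing Implicit Defensive.

Import Order.TTheory GRing.Theory Num.Theory.
Import numFieldNormedType.Exports.

Local Open Scope classical_set_scope.
Local Open Scope ring_scope.

Variant scalars := RealScalars | ComplexScalars.

Definition scalar_field (R : realType) (s : scalars) : numFieldType :=
  match s with
  | RealScalars => R
  | ComplexScalars => complex R
  end.

Definition real_part (R : realType) (s : scalars) : scalar_field R s -> R :=
  match s with
  | RealScalars => fun z => z
  | ComplexScalars => fun z => complex.Re z
  end.

(* The library norm of a normed space over K takes its values in K itself; they
   are real, and [rnorm] is the same norm with values in R. *)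
Definition rnorm (R : realType) (s : scalars)
    (V : normedModType (scalar_field R s)) (x : V) : R :=
  real_part `|x|.

Section SequenceSpaces.
Variables (R : realType) (s : scalars).
Local Notation K := (scalar_field R s).

Definition lp (p : R) (V : normedModType K) : set (nat -> V) :=
  [set x | (\sum_(0 <= j <oo) (rnorm (x j) `^ p)%:E < +oo)%E].
Local Arguments lp : clear implicits.

Definition bounded_functional (V : normedModType K) (phi : {linear V -> K^o}) :=
  exists C : R, forall x : V, rnorm (phi x) <= C * rnorm x.

Definition weak_lp (p : R) (V : normedModType K) : set (nat -> V) :=
  [set x | forall phi : {linear V -> K^o}, bounded_functional phi ->
     lp p K^o (fun j => phi (x j))].

End SequenceSpaces.
Arguments lp {R s} p V.
Arguments weak_lp {R s} p V.

Section MultilinearMaps.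
Variables (R : realType) (s : scalars) (n : nat).
Local Notation K := (scalar_field R s).
Variables (E : 'I_n -> completeNormedModType K) (F : completeNormedModType K).

Definition multilinear (T : (forall i, E i) -> F) :=
  forall (i : 'I_n) (x : forall k, E k),
    linear (fun u : E i => T (eqtype.dfwith x u)).

Definition bounded_multilinear : set ((forall i, E i) -> F) :=
  [set T | multilinear T /\
     exists C : R, forall x : forall i, E i,
       rnorm (T x) <= C * \prod_(i < n) rnorm (x i)].

Definition absolutely_summing (p : R) (q : 'I_n -> R) :
    set ((forall i, E i) -> F) :=
  [set T | bounded_multilinear T /\
     forall x : forall i, nat -> E i,
       (forall i, weak_lp (q i) (E i) (x i)) ->
       lp p F (fun j => T (fun i => x i j))].

End MultilinearMaps.
Arguments multilinear {R s n} E F T.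
Arguments bounded_multilinear {R s n} E F.
Arguments absolutely_summing {R s n} E F p q.

(* The family (a_0, ..., a_(m-1), b_0, ..., b_(n-m-1)). *)
Definition append (A : Type) (m n : nat) (le_mn : (m <= n)%N)
    (a : 'I_m -> A) (b : 'I_(n - m) -> A) (i : 'I_n) : A :=
  match split (cast_ord (esym (subnKC le_mn)) i) with
  | inl j => a j
  | inr k => b k
  end.

(* Main.v *)
From HB Require Import structures.
Require Import Defs.
From mathcomp Require Import functions ring lra.
Import Order.TTheory GRing.Theory Num.Theory.
Import numFieldNormedType.Exports.
Local Open Scope classical_set_scope.
Local Open Scope ring_scope.

Set Implicit Arguments.
Unset Strict Implicit.
Unset Printing Implicit Defensive.

(** Write H_i for the n factor spaces, let T be a bounded n-linear map on them,
and let x_i be weakly q_i-summable in H_i for i < m and weakly 1-summable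
afterwards.  The variables after the first m are absorbed one at a time: for
m <= t <= n the claim is that, for every choice of fixed vectors g_i, the
vectors obtained from T by putting x_i(j) in the slots i < t and g_i in the
other slots have summable norms.  For t = m this is the hypothesis, applied to
the m-linear map that T becomes when its last variables are frozen
([summable_up_to_start]); for t = n it is the conclusion.

The step from t to t + 1 ([summable_up_to_next]) is a statement about the single
space V = H_t.  Let p_j(w) be the norm of the j-th vector when w is put in slot t:
these are continuous seminorms, and for every fixed w their values are summable.
If y is weakly 1-summable in V, then p_j(y_j) is summable
([diagonal_summable]).  Three facts give this.

- Uniform boundedness on the Banach space V improves pointwise summability to
  sum_j p_j(w) <= C |w| ([uniform_boundedness]).
- The signed sums of a weakly 1-summable sequence are norm bounded
  ([signed_sums_bounded]): sum_k |u(y_k)| is bounded uniformly over the unit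
  ball of the dual, by uniform boundedness again, and the Hahn-Banach theorem
  recovers the norm from the functionals.
- Signs can be chosen one after the other so that the signed sum
  w = sum_(k < n) +-y_k satisfies sum_(j < n) p_j(y_j) <= sum_(j < n) p_j(w)
  ([signs_dominating_diagonal]).  This replaces averaging over the Rademacher
  functions.

All of this takes place over the reals.  A space over the scalar field is
regarded as a real space, and a real functional u on a complex space is the real
part of the complex functional x |-> u(x) - i u(ix), so that weak summability
passes to real functionals. *)

(** * The scalar field as an extension of the reals *)

Section Scalars.
Variables (R : realType) (s : scalars).
Local Notation K := (scalar_field R s).

Definition of_real : R -> K :=
  match s return R -> scalar_field R s with
  | RealScalars => fun t => t
  | ComplexScalars => fun t => (t%:C)%C
  end.

Lemma of_real_is_zmod_morphism : zmod_morphism of_real.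
Proof. by rewrite /of_real; case: s => //= x y; rewrite rmorphB. Qed.
Lemma of_real_is_monoid_morphism : monoid_morphism of_real.
Proof.
rewrite /of_real; case: s => /=; first by [].
by split=> [|x y]; rewrite ?rmorphM ?rmorph1.
Qed.
HB.instance Definition _ :=
  GRing.isZmodMorphism.Build R K of_real of_real_is_zmod_morphism.
HB.instance Definition _ :=
  GRing.isMonoidMorphism.Build R K of_real of_real_is_monoid_morphism.

Lemma of_realK : cancel of_real (@real_part R s).
Proof. by rewrite /of_real /real_part; case: s. Qed.

Lemma ler_of_real a b : (of_real a <= of_real b) = (a <= b).
Proof. by rewrite /of_real; case: s => //=; rewrite lecR. Qed.

Lemma ltr_of_real a b : (of_real a < of_real b) = (a < b).
Proof. by rewrite !lt_neqAle ler_of_real (can_eq of_realK). Qed.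

Lemma real_partK (z : K) : 0 <= z -> of_real (real_part z) = z.
Proof.
rewrite /of_real /real_part; case: s z => //= -[a b].
by rewrite lecE /= => /andP[/eqP-> _].
Qed.

Lemma normr_of_real t : `|of_real t| = of_real `|t|.
Proof.
have [t0|/ltW t0] := leP 0 t.
  by rewrite !ger0_norm// -(rmorph0 of_real) ler_of_real.
by rewrite !ler0_norm ?rmorphN// -(rmorph0 of_real) ler_of_real.
Qed.

Variable V : normedModType K.
Implicit Types x y : V.

Lemma of_real_rnorm x : of_real (rnorm x) = `|x|.
Proof. by rewrite /rnorm real_partK. Qed.

Lemma rnorm_ge0 x : 0 <= rnorm x.
Proof. by rewrite -ler_of_real rmorph0 of_real_rnorm. Qed.

Lemma ler_rnormD x y : rnorm (x + y) <= rnorm x + rnorm y.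
Proof. by rewrite -ler_of_real rmorphD /= !of_real_rnorm ler_normD. Qed.

Lemma rnormN x : rnorm (- x) = rnorm x.
Proof. by rewrite /rnorm normrN. Qed.

Lemma rnormZ t x : rnorm (of_real t *: x) = `|t| * rnorm x.
Proof.
apply: (can_inj of_realK).
by rewrite rmorphM /= !of_real_rnorm normrZ normr_of_real.
Qed.

End Scalars.

(** * Geometric series in a Banach space *)

Lemma exp_third_small (R : realType) (C e : R) :
  0 < e -> exists N, (1 / 3) ^+ N * C < e.
Proof.
move=> e0; pose N := (Num.truncn (C / e)).+1; exists N.
have : C / e < (3 ^ N)%:R.
  apply: (@lt_le_trans _ _ N%:R); first exact: truncnS_gt.
  by rewrite ler_nat; apply: ltnW; exact: ltn_expl.
rewrite ltr_pdivrMr// natrX => h.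
by rewrite expr_div_n expr1n mulrAC mul1r ltr_pdivrMr ?exprn_gt0// mulrC.
Qed.

Section Geometric.
Variables (R : realType) (s : scalars).
Local Notation K := (scalar_field R s).
Variable V : completeNormedModType K.

(** The weights (2/3) 3^-k add up to 1, so partial sums N and M >= N differ by at
most (3^-N - 3^-M) C; the series is Cauchy, and the bound survives in the limit. *)
Lemma geometric_series_limit (C : R) (u : nat -> V) :
  (forall n, rnorm (u n) <= C) ->
  exists l, forall N,
    rnorm (l - \sum_(k < N) of_real s ((1 / 3) ^+ k * (2 / 3)) *: u k)
      <= (1 / 3) ^+ N * C.
Proof.
move=> uC; pose S N := \sum_(k < N) of_real s ((1 / 3) ^+ k * (2 / 3)) *: u k.
have C0 : 0 <= C by exact: le_trans (rnorm_ge0 _) (uC 0%N).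
have tail N j : rnorm (S (N + j)%N - S N) <= ((1 / 3) ^+ N - (1 / 3) ^+ (N + j)) * C.
  elim: j => [|j IH].
    by rewrite addn0 !subrr mul0r /rnorm normr0 -[0](rmorph0 (of_real s)) of_realK.
  rewrite addnS /S big_ord_recr/= -/(S _) addrAC.
  apply: le_trans (ler_rnormD _ _) _; rewrite rnormZ ger0_norm; last first.
    by rewrite mulr_ge0// exprn_ge0.
  have h : (1 / 3) ^+ (N + j) * (2 / 3) * rnorm (u (N + j)%N)
      <= (1 / 3) ^+ (N + j) * (2 / 3) * C.
    by rewrite ler_wpM2l// mulr_ge0// exprn_ge0.
  by rewrite exprS; move: IH h; move: (_ ^+ N) (_ ^+ (N + j)) => a b; lra.
have tailC N M : (N <= M)%N -> rnorm (S M - S N) <= (1 / 3) ^+ N * C.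
  move=> /subnKC <-; apply: le_trans (tail N _) _.
  by rewrite ler_wpM2r// gerBl exprn_ge0.
have cS : cauchy (S @ \oo).
  apply: cauchy_exP => e e0.
  have re : of_real s (real_part e) = e by rewrite real_partK// ltW.
  have [|N hN] := @exp_third_small _ C (real_part e).
    by rewrite -(ltr_of_real s) rmorph0 re.
  exists (S N); exists N => // M NM; rewrite /= -ball_normE/=.
  rewrite -re -of_real_rnorm ltr_of_real -rnormN opprB.
  exact: le_lt_trans (tailC _ _ NM) hN.
have /cauchy_cvgP/cvg_ex[l Sl] := cS.
exists l => N; apply/ler_addgt0Pr => e e0.
move/cvgrPdist_lt: Sl => /(_ (of_real s e)).
rewrite -{1}(rmorph0 (of_real s)) ltr_of_real => /(_ e0)[M _ hM].
have := hM (maxn M N) (leq_maxl _ _).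
rewrite -of_real_rnorm ltr_of_real => h.
have -> : l - S N = (S (maxn M N) - S N) + (l - S (maxn M N)).
  by rewrite [RHS]addrC addrA subrK.
apply: le_trans (ler_rnormD _ _) _.
by rewrite lerD ?tailC ?leq_maxr// ltW.
Qed.

(** The vectors r_n are the normalised tails sum_k (2/3) 3^-k u_(n+k) of one
series.  The recursion between them encodes its convergence without limits, and
for bounded r it determines r. *)
Lemma geometric_tails (C : R) (u : nat -> V) :
  (forall n, rnorm (u n) <= C) ->
  exists r : nat -> V, (forall n, rnorm (r n) <= C) /\
    forall n, r n = of_real s (2 / 3) *: u n + of_real s (1 / 3) *: r n.+1.
Proof.
move=> uC.
have /choice[r hr] n : exists l, forall N,
    rnorm (l - \sum_(k < N) of_real s ((1 / 3) ^+ k * (2 / 3)) *: u (n + k)%N)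
      <= (1 / 3) ^+ N * C.
  by apply: (geometric_series_limit (u := fun k => u (n + k)%N)) => k.
exists r; split=> n.
  by have := hr n 0%N; rewrite big_ord0 subr0 expr0 mul1r.
(* Replacing both tails by partial sums bounds the defect d by 3^-N C for all N. *)
set d := r n - (of_real s (2 / 3) *: u n + of_real s (1 / 3) *: r n.+1).
suff d0 : rnorm d <= 0.
  apply/eqP; rewrite -subr_eq0 -/d -normr_eq0 -of_real_rnorm.
  by rewrite (_ : rnorm d = 0) ?rmorph0//; apply: le_anti; rewrite d0 rnorm_ge0.
apply/ler_addgt0Pr => e e0; rewrite add0r.
have [N hN] := exp_third_small C e0.
apply: le_trans (ltW hN).
have h1 := hr n N.+1; have h2 := hr n.+1 N.
pose a := r n - \sum_(k < N.+1) of_real s ((1 / 3) ^+ k * (2 / 3)) *: u (n + k)%N.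
pose b := r n.+1 - \sum_(k < N) of_real s ((1 / 3) ^+ k * (2 / 3)) *: u (n.+1 + k)%N.
have -> : d = a + of_real s (- (1 / 3)) *: b.
  rewrite /a /b big_ord_recl/= expr0 mul1r addn0 scalerBr scaler_sumr.
  rewrite (_ : \sum_(i < N) of_real s (- (1 / 3)) *: _ =
    - \sum_(k < N) of_real s ((1 / 3) ^+ k.+1 * (2 / 3)) *: u (n + k.+1)%N).
    rewrite rmorphN scaleNr opprK /d !opprD; set S := \sum_(_ < _) _.
    rewrite -[in RHS]addrA; congr (_ + _); rewrite -[RHS]addrA; congr (_ + _).
    by rewrite addrCA addNr addr0.
  rewrite -sumrN; apply: eq_bigr => k _.
  rewrite scalerA addnS addSn -[RHS]scaleNr; congr (_ *: _).
  by rewrite rmorphN mulNr -rmorphM exprS -[in RHS]mulrA.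
apply: le_trans (ler_rnormD _ _) _; rewrite rnormZ normrN ger0_norm//.
move: h1 h2 (rnorm_ge0 b); rewrite -/a -/b exprS; move: (rnorm a) (rnorm b) => x y.
by move: ((1 / 3) ^+ N) => t; lra.
Qed.

End Geometric.

(** * Hahn-Banach for sublinear functionals *)

Section HahnBanach.
Variables (R : realType) (V : lmodType R).
Implicit Types (p q u : V -> R) (x y : V).

Definition sublinear p :=
  (forall x y, p (x + y) <= p x + p y) /\
  (forall t x, 0 <= t -> p (t *: x) = t * p x).

Lemma sublinear0 p : sublinear p -> p 0 = 0.
Proof. by case=> _ pZ; rewrite -(scale0r 0) pZ// mul0r. Qed.

Lemma sublinear_ge p x : sublinear p -> - p (- x) <= p x.
Proof.
move=> sp; have [pD _] := sp; have := pD x (- x).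
by rewrite subrr sublinear0// -subr_ge0 => h; rewrite lerNl -subr_ge0; lra.
Qed.

Lemma sublinear_linear q :
  sublinear q -> (forall x y, q x + q y <= q (x + y)) -> linear (q : V -> R^o).
Proof.
move=> sq qD'; have [qD qZ] := sq.
have qDE x y : q (x + y) = q x + q y by apply/eqP; rewrite eq_le qD qD'.
have qN x : q (- x) = - q x.
  by have := qDE x (- x); rewrite subrr sublinear0// => h; lra.
move=> t x y; rewrite qDE; congr (_ + _).
have [t0|/ltW t0] := leP 0 t; first exact: qZ.
have -> : t *: x = - ((- t) *: x) by rewrite scaleNr opprK.
by rewrite qN qZ ?oppr_ge0// mulNr opprK.
Qed.

(** An infimum of functionals that are sublinear only up to changing the member
of the family is sublinear.  This serves both for chains, where two members are
compared with the smaller one, and for [directional], whose members are not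
homogeneous individually. *)
Lemma sublinear_inf (A : set (V -> R)) (l : V -> R) :
  A !=set0 -> (forall f x, A f -> l x <= f x) -> (forall f, A f -> f 0 = 0) ->
  (forall f g x y, A f -> A g -> exists2 h, A h & h (x + y) <= f x + g y) ->
  (forall f t x, A f -> 0 < t -> exists2 h, A h & h (t *: x) <= t * f x) ->
  sublinear (fun x => inf [set f x | f in A]).
Proof.
move=> [f0 Af0] lA A0 AD AZ; pose Q x := inf [set f x | f in A].
have Qle f x : A f -> Q x <= f x.
  by move=> Af; apply: ge_inf; [exists (l x) => _ [g Ag <-]; exact: lA|exists f].
have leQ x c : (forall f, A f -> c <= f x) -> c <= Q x.
  move=> cf; apply: lb_le_inf; first by exists (f0 x), f0.
  by move=> _ [g Ag <-]; exact: cf.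
have QZle t x : 0 < t -> Q (t *: x) <= t * Q x.
  move=> t0; rewrite -ler_pdivrMl//; apply: (leQ) => f Af.
  rewrite ler_pdivrMl//; have [h Ah] := AZ f t x Af t0.
  exact: le_trans (Qle _ _ Ah).
split=> [x y|t x].
  rewrite -[leRHS]/(Q x + Q y) -[leLHS]/(Q (x + y)) -lerBlDr.
  apply: (leQ) => f Af; rewrite lerBlDr -lerBlDl; apply: (leQ) => g Ag.
  rewrite lerBlDl; have [h Ah] := AD f g x y Af Ag.
  exact: le_trans (Qle _ _ Ah).
rewrite le_eqVlt => /predU1P[<-|t0].
  rewrite mul0r scale0r -[LHS]/(Q 0); apply/eqP; rewrite eq_le -{1}(A0 _ Af0).
  by rewrite Qle//=; apply: (leQ) => f /A0 ->.
rewrite -[RHS]/(t * Q x) -[LHS]/(Q (t *: x)).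
apply/eqP; rewrite eq_le QZle//= -ler_pdivlMl//.
have /QZle : 0 < t^-1 by rewrite invr_gt0.
by move=> /(_ (t *: x)); rewrite scalerA mulVf ?gt_eqF// scale1r.
Qed.

(** The one-sided derivative of q at y in the direction x: for t > 0 the value
q(x + ty) - t q(y) is the difference quotient with step 1/t. *)
Definition directional q y x :=
  inf [set f x | f in
    [set f | exists2 t, 0 <= t & f = fun x => q (x + t *: y) - t * q y]].

Lemma directional_sublinear q y : sublinear q ->
  [/\ sublinear (directional q y), forall x, directional q y x <= q x
    & forall x, directional q y x <= q (x + y) - q y].
Proof.
move=> sq; have [qD qZ] := sq.
have lb t x : 0 <= t -> - q (- x) <= q (x + t *: y) - t * q y.
  move=> t0; rewrite -qZ//; have := qD (x + t *: y) (- x).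
  by rewrite addrAC subrr add0r => h; lra.
have dle t x : 0 <= t -> directional q y x <= q (x + t *: y) - t * q y.
  move=> t0; apply: ge_inf.
    by exists (- q (- x)) => _ [_ [t' t'0 ->] <-]; exact: lb.
  by exists (fun x => q (x + t *: y) - t * q y) => //; exists t.
split.
- apply: (@sublinear_inf _ (fun x => - q (- x))).
  + by exists (fun x => q (x + 0 *: y) - 0 * q y), 0.
  + by move=> _ x [t t0 ->]; exact: lb.
  + by move=> _ [t t0 ->]; rewrite add0r qZ// subrr.
  + move=> _ _ x z [t t0 ->] [t' t'0 ->].
    exists (fun x => q (x + (t + t') *: y) - (t + t') * q y).
      by exists (t + t') => //; rewrite addr_ge0.
    have := qD (x + t *: y) (z + t' *: y).
    by rewrite addrACA -scalerDl => h; lra.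
  + move=> _ c x [t t0 ->] c0.
    exists (fun x => q (x + (c * t) *: y) - (c * t) * q y).
      by exists (c * t) => //; rewrite mulr_ge0// ltW.
    by rewrite /= -scalerA -scalerDr qZ ?(ltW c0)// mulrBr mulrA.
- by move=> x; have := dle 0 x (lexx _); rewrite scale0r addr0 mul0r subr0.
- by move=> x; have := dle 1 x ler01; rewrite scale1r mul1r.
Qed.

(** Zorn's lemma for the reversed pointwise order: a chain has a pointwise infimum
because every sublinear f <= p satisfies f(x) >= - p(- x). *)
Lemma minimal_sublinear p : sublinear p ->
  exists q, [/\ sublinear q, forall x, q x <= p x &
    forall r, sublinear r -> (forall x, r x <= q x) -> r = q].
Proof.
move=> sp.
pose T := {q : V -> R | sublinear q /\ forall x, q x <= p x}.
pose below (q r : T) := `[< forall x, sval r x <= sval q x >].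
have [||||q qmin] := @Zorn T below.
- by move=> q; apply/asboolP.
- move=> q r s /asboolP qr /asboolP rs; apply/asboolP => x.
  exact: le_trans (rs x) (qr x).
- move=> [q hq] [r hr] /asboolP/= qr /asboolP/= rq; apply: eq_exist.
  by apply: funext => x; apply/eqP; rewrite eq_le qr rq.
- move=> A Atot.
  (* Adding p keeps the family nonempty when the chain A is empty. *)
  pose B := [set sval f | f in A] `|` [set p].
  have Bp f : B f -> sublinear f /\ forall x, f x <= p x.
    by case=> [[[g hg] _ <-]//|-> //].
  have Btot f g : B f -> B g -> (forall x, f x <= g x) \/ (forall x, g x <= f x).
    move=> [[f' Af <-]|->] [[g' Ag <-]|->].
    + by have [/asboolP|/asboolP] := Atot _ _ Af Ag; [right|left].
    + by left; case: (svalP f').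
    + by right; case: (svalP g').
    + by left.
  have lb f x : B f -> - p (- x) <= f x.
    move=> /Bp[sf fp]; apply: le_trans (sublinear_ge x sf).
    by rewrite lerN2.
  have sQ : sublinear (fun x => inf [set f x | f in B]).
    apply: (@sublinear_inf _ (fun x => - p (- x))).
    + by exists p; right.
    + by move=> f x /lb.
    + by move=> f /Bp[/sublinear0].
    + move=> f g x y Bf Bg; have [fg|gf] := Btot _ _ Bf Bg.
        exists f => //; have [[fD _] _] := Bp _ Bf.
        by apply: le_trans (fD _ _) _; rewrite lerD2l.
      exists g => //; have [[gD _] _] := Bp _ Bg.
      by apply: le_trans (gD _ _) _; rewrite lerD2r.
    + move=> f t x Bf t0; exists f => //; have [[_ fZ] _] := Bp _ Bf.
      by rewrite fZ// ltW.
  have Qle f x : B f -> inf [set f x | f in B] <= f x.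
    move=> Bf; apply: ge_inf; last by exists f.
    by exists (- p (- x)) => _ [g Bg <-]; exact: lb.
  have hQ : sublinear (fun x => inf [set f x | f in B]) /\
      forall x, inf [set f x | f in B] <= p x.
    by split=> // x; apply: Qle; right.
  pose t : T := exist (fun q => sublinear q /\ forall x, q x <= p x) _ hQ.
  exists t => f Af; apply/asboolP => x /=.
  by apply: Qle; left; exists f.
case: q qmin => q [sq qp] qmin; exists q; split=> // r sr rq.
have hr : sublinear r /\ forall x, r x <= p x.
  by split=> // x; exact: le_trans (rq x) (qp x).
pose t : T := exist (fun q => sublinear q /\ forall x, q x <= p x) _ hr.
by have /(congr1 sval) : t = exist _ q (conj sq qp) by apply: qmin; exact/asboolP.
Qed.

(** A minimal sublinear functional q is linear: [directional q y] lies below q,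
hence equals q, and this gives q(x) + q(y) <= q(x + y).  Taking q below the
directional functional of p at x0 forces q(- x0) <= - p(x0), so the bound p is
attained at x0. *)
Theorem hahn_banach p x0 : sublinear p ->
  exists u : V -> R^o, [/\ linear u, forall x, u x <= p x & u x0 = p x0].
Proof.
move=> sp; have [sd dp dx0] := directional_sublinear x0 sp.
have [q [sq qd qmin]] := minimal_sublinear sd.
have lq : linear (q : V -> R^o).
  apply: sublinear_linear => // x y.
  have [sd' dq dy] := directional_sublinear y sq.
  by rewrite -lerBrDr; have /(_ x) := dy; rewrite (qmin _ sd' dq).
exists q; split=> // [x|]; first exact: le_trans (qd x) (dp x).
apply/eqP; rewrite eq_le (le_trans (qd x0) (dp x0))/=.
have := le_trans (qd (- x0)) (dx0 (- x0)).
rewrite addNr sublinear0// sub0r.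
have -> : q (- x0) = - q x0.
  have := lq (-1) x0 0; rewrite addr0 scaleN1r sublinear0// addr0.
  by rewrite scaleN1r.
by rewrite lerN2.
Qed.

End HahnBanach.

(** * Uniform boundedness on Banach disks *)

Section UniformBoundedness.
Variables (R : realType) (V : lmodType R).
Implicit Types (p : V -> R) (U : set V).

Definition seminorm p :=
  (forall x y, p (x + y) <= p x + p y) /\
  (forall t x, p (t *: x) = `|t| * p x).

Lemma seminormN p x : seminorm p -> p (- x) = p x.
Proof. by case=> _ pZ; rewrite -scaleN1r pZ normrN1 mul1r. Qed.

Lemma seminorm0 p : seminorm p -> p 0 = 0.
Proof. by case=> _ pZ; rewrite -(scale0r 0) pZ normr0 mul0r. Qed.

Lemma seminorm_parallel p x y : seminorm p -> 2 * p x <= p (x + y) + p (x - y).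
Proof.
move=> sp; have := sp.1 (x + y) (x - y); rewrite addrACA subrr addr0.
by rewrite -mulr2n -scaler_nat sp.2 ger0_norm.
Qed.

(** This is the completeness that a gliding hump uses: the vectors r_n are the
normalised tails of the series sum_k (2/3) 3^-k u_k.  Closed unit balls of Banach
spaces are examples.  Since no norm occurs, the unit ball of the dual can be
treated inside the space of all functions. *)
Definition banach_disk U :=
  (forall u, U u -> U (- u)) /\
  forall u : nat -> V, (forall n, U (u n)) ->
    exists r : nat -> V, (forall n, U (r n)) /\
      forall n, r n = (2 / 3) *: u n + (1 / 3) *: r n.+1.

(** Gliding hump.  If the bounds sigma of p_n over U are not bounded in n, pick
indices n_k with sigma_k >= 6 k 3^k and nearly extremal v_k in U, and form the
series of (2/3) 3^-k (+- v_k).  For one of the two signs the partial sum up to k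
has p_(n_k)-value at least (2/3) 3^-k p_(n_k)(v_k) >= (1/2) 3^-k sigma_k,
whatever the earlier terms are, because p(s + d) + p(s - d) >= 2 p(d).  The
remaining tail contributes at most (1/3) 3^-k sigma_k, so that p_(n_k) >= k at
the sum of the series. *)
Lemma uniform_boundedness U (p : nat -> V -> R) :
  banach_disk U -> (forall n, seminorm (p n)) ->
  (forall n, exists c, forall u, U u -> p n u <= c) ->
  (forall u, U u -> exists M, forall n, p n u <= M) ->
  exists C, forall n u, U u -> p n u <= C.
Proof.
move=> [UN Ugeo] sp pU pbd; apply: contrapT => unb.
have humps k : exists nvs : nat * V * R, let: (n, v, sigma) := nvs in
    [/\ U v, k%:R <= (1 / 3) ^+ k * (sigma / 6), 3 / 4 * sigma <= p n v &
      forall u, U u -> p n u <= sigma].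
  (* The index k + 1 keeps B positive for k = 0. *)
  pose B : R := 3 ^+ k * (6 * k.+1%:R).
  have [n [u Uu Bp]] : exists n, exists2 u, U u & B < p n u.
    apply: contrapT => nB; apply: unb; exists B => n u Uu.
    by rewrite leNgt; apply/negP => Bp; apply: nB; exists n, u.
  have B0 : 0 < B by rewrite /B !mulr_gt0// exprn_gt0.
  have hs : has_sup [set p n v | v in U].
    split; first by exists (p n u), u.
    by have [c hc] := pU n; exists c => _ [v Uv <-]; exact: hc.
  set sigma := sup [set p n v | v in U].
  have le_sigma v : U v -> p n v <= sigma.
    by move=> Uv; apply: ub_le_sup; [exact: hs.2|exists v].
  have s0 : 0 < sigma / 4.
    by rewrite divr_gt0// (lt_le_trans B0)// (le_trans (ltW Bp))// le_sigma.
  have [_ [v Uv <-] hv] := sup_adherent s0 hs.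
  exists (n, v, sigma); split=> //.
    have -> : k%:R = (1 / 3) ^+ k * (3 ^+ k * (6 * k%:R) / 6) :> R.
      rewrite !mulrA -exprMn divfK// expr1n mul1r.
      by rewrite mulrAC divff// mul1r.
    rewrite ler_wpM2l// ?exprn_ge0// ler_pM2r//.
    apply: le_trans (le_sigma _ Uu); apply: le_trans (ltW Bp).
    by rewrite ler_wpM2l// ?exprn_ge0// ler_wpM2l// ler_nat.
  by apply: ltW; apply: le_lt_trans hv; rewrite -/sigma; lra.
have {humps} [f hf] := choice humps.
pose n k := (f k).1.1; pose v k := (f k).1.2; pose sigma k := (f k).2.
have {}hf k : [/\ U (v k), k%:R <= (1 / 3) ^+ k * (sigma k / 6),
    3 / 4 * sigma k <= p (n k) (v k) &
    forall u, U u -> p (n k) u <= sigma k].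
  by have := hf k; rewrite /n /v /sigma; case: (f k) => [[]].
pose c k : R := (1 / 3) ^+ k * (2 / 3).
have c0 k : 0 <= c k by rewrite mulr_ge0// exprn_ge0.
pose signed k s := if p (n k) (s - c k *: v k) <= p (n k) (s + c k *: v k)
  then v k else - v k.
pose fix s k := if k is k'.+1 then s k' + c k' *: signed k' (s k') else 0.
pose u k := signed k (s k).
have Uu k : U (u k).
  by rewrite /u /signed; have [Uv _ _ _] := hf k; case: ifP => // _; exact: UN.
have s_big k : c k * p (n k) (v k) <= p (n k) (s k.+1).
  have -> : c k * p (n k) (v k) = p (n k) (c k *: v k).
    by rewrite (sp _).2 ger0_norm.
  have par : 2 * p (n k) (c k *: v k) <=
      p (n k) (s k + c k *: v k) + p (n k) (s k - c k *: v k).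
    rewrite -(seminormN (s k - _) (sp _)) opprB addrC (addrC (s k)) addrC.
    exact: seminorm_parallel.
  move: par; rewrite /= /signed.
  by case: ifP => [|/negbT]; rewrite -?ltNge ?scalerN; lra.
have [r [Ur rE]] := Ugeo u Uu.
have r0E k : r 0%N = s k + (1 / 3) ^+ k *: r k.
  elim: k => [|k IH]; first by rewrite expr0 scale1r add0r.
  by rewrite IH {1}rE scalerDr !scalerA /= -addrA /c exprSr.
have [M hM] := pbd _ (Ur 0%N).
pose k := (Num.truncn `|M|).+1.
have kM : M < k%:R by apply: le_lt_trans (ler_norm _) _; exact: truncnS_gt.
have [Uv ks pv ps] := hf k.
have h1 := hM (n k); have h2 := s_big k.
have h3 : p (n k) (s k.+1) <= p (n k) (r 0%N) + (1 / 3) ^+ k.+1 * sigma k.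
  have -> : s k.+1 = r 0%N + (1 / 3) ^+ k.+1 *: (- r k.+1).
    by rewrite (r0E k.+1) scalerN addrK.
  apply: le_trans ((sp _).1 _ _) _; rewrite lerD2l (sp _).2.
  rewrite ger0_norm ?exprn_ge0// ler_wpM2l// ?exprn_ge0//.
  by rewrite (seminormN _ (sp _)) ps.
have h4 : c k * (3 / 4 * sigma k) <= c k * p (n k) (v k) by rewrite ler_wpM2l.
rewrite exprSr in h3; rewrite /c in h2 h4.
by move: ks h1 h2 h3 h4 kM; move: ((1 / 3) ^+ k) => e; lra.
Qed.

End UniformBoundedness.

(** * Weakly summable sequences in a seminormed real space *)

Section WeaklySummable.
Variables (R : realType) (V : lmodType R).
Implicit Types (N : V -> R) (y : nat -> V) (u : V -> R^o).

(** Summability, for nonnegative terms. *)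
Definition bounded_sums (a : nat -> R) := exists M, forall n, \sum_(i < n) a i <= M.

Lemma eq_bounded_sums (a b : nat -> R) :
  a =1 b -> bounded_sums a -> bounded_sums b.
Proof. by move=> /funext ->. Qed.

Lemma seminorm_sum (W : lmodType R) (p : nat -> W -> R) n :
  (forall j, seminorm (p j)) -> seminorm (fun x => \sum_(j < n) p j x).
Proof.
move=> sp; split=> [x y|t x].
  by rewrite -big_split; apply: ler_sum => j _; exact: (sp j).1.
by rewrite mulr_sumr; apply: eq_bigr => j _; exact: (sp j).2.
Qed.

Definition dual_ball N : set (V -> R^o) :=
  [set u : V -> R^o | linear u /\ forall x, (u x : R) <= N x].

Lemma dual_ball_norm N u x : seminorm N -> dual_ball N u -> `|u x| <= N x.
Proof.
move=> sN [lu uN]; rewrite ler_norml uN andbT lerNl -(seminormN x sN).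
have := uN (- x); suff -> : u (- x) = - u x by [].
have := lu (-2) x x.
rewrite -{2}[x]scale1r -scalerDl (_ : -2 + 1 = -1); last by ring.
by rewrite scaleN1r => ->; rewrite -[_ *: _]/(-2 * u x); ring.
Qed.

(** The series of functionals converges pointwise.  The sum is linear because its
defect d satisfies d_k = d_(k+1) / 3 and is bounded in k, hence vanishes. *)
Lemma dual_ball_disk N : seminorm N -> banach_disk (dual_ball N).
Proof.
move=> sN; split=> [u du|u du].
  split=> [a x y|x]; last first.
    apply: le_trans (dual_ball_norm x sN du); apply: le_trans (ler_norm _) _.
    by rewrite normrN.
  by rewrite !fctE du.1 opprD scalerN.
have uN n x : `|u n x| <= N x by exact: dual_ball_norm.
have /choice[r hr] x := @geometric_tails R RealScalars R^o (N x) (u^~ x) (uN^~ x).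
exists (fun n x => r x n); split=> [n|n]; last first.
  by apply: funext => x; exact: (hr x).2.
have rN x k : `|r x k| <= N x by exact: (hr x).1.
have rE x k : r x k = 2 / 3 * u k x + 1 / 3 * r x k.+1 by exact: (hr x).2.
split=> [a x y|x]; last exact: le_trans (ler_norm _) (rN _ _).
pose d k := r (a *: x + y) k - (a * r x k + r y k).
have dE k : d k = 1 / 3 * d k.+1.
  rewrite /d (rE _ k) (rE x k) (rE y k) (du k).1.
  by rewrite -[a *: u k x]/(a * u k x); ring.
pose B := N (a *: x + y) + (`|a| * N x + N y).
have dB k : `|d k| <= B.
  apply: le_trans (ler_normB _ _) _; apply: lerD => //.
  apply: le_trans (ler_normD _ _) _; apply: lerD => //.
  by rewrite normrM ler_wpM2l.
have dpow k : `|d n| <= (1 / 3) ^+ k * B.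
  suff -> : d n = (1 / 3) ^+ k * d (n + k)%N.
    by rewrite normrM ger0_norm ?exprn_ge0// ler_wpM2l ?exprn_ge0.
  elim: k => [|k ->]; first by rewrite addn0 expr0 mul1r.
  by rewrite addnS dE mulrA -exprSr.
apply/eqP; rewrite -subr_eq0 -normr_le0 -[_ - _]/(d n).
apply/ler_addgt0Pr => e e0; rewrite add0r.
have [k hk] := exp_third_small B e0.
exact: le_trans (dpow k) (ltW hk).
Qed.

Definition signed_sum y (e : nat -> bool) n := \sum_(k < n) (-1) ^+ e k *: y k.

Definition weakly_summable N y :=
  forall u, dual_ball N u -> bounded_sums (fun k => `|u (y k)|).

Lemma seminorm_sublinear N : seminorm N -> sublinear N.
Proof. by case=> ND NZ; split=> // t x t0; rewrite NZ ger0_norm. Qed.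

(** Uniform boundedness on the dual ball bounds sum_k |u(y_k)|, hence u(w) for
every signed sum w, independently of u; Hahn-Banach provides u with u(w) = N(w). *)
Lemma signed_sums_bounded N y : seminorm N -> weakly_summable N y ->
  exists C, forall e n, N (signed_sum y e n) <= C.
Proof.
move=> sN wy.
pose p n (u : V -> R^o) := \sum_(k < n) `|u (y k)|.
have [|||C hC] :=
    @uniform_boundedness R (V -> R^o) (dual_ball N) p (dual_ball_disk sN).
- move=> n; apply: (@seminorm_sum _ (fun k (u : V -> R^o) => `|u (y k)|)) => j.
  by split=> [f g|t f]; [exact: ler_normD|exact: normrM].
- move=> n; exists (\sum_(k < n) N (y k)) => u du.
  by apply: ler_sum => k _; exact: dual_ball_norm.
- by move=> u /wy.
exists C => e n.
have [u [lu uN <-]] := hahn_banach (signed_sum y e n) (seminorm_sublinear sN).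
apply: le_trans (hC n u (conj lu uN)).
have du : dual_ball N u by [].
rewrite /p; elim: n => [|n IH].
  rewrite /signed_sum !big_ord0 -[leRHS](seminorm0 sN); exact: uN.
rewrite /signed_sum !big_ord_recr/= addrC lu addrC; apply: lerD => //.
rewrite -[_ *: _]/(_ * _); apply: le_trans (ler_norm _) _.
by rewrite normrM normrX normrN1 expr1n mul1r.
Qed.

(** When y_n is added with either sign to the signed sum s of the earlier terms,
the average of p_j(s + y_n) and p_j(s - y_n) is at least p_j(s) for j < n and at
least p_n(y_n) for j = n.  One of the two signs does at least as well as the
average. *)
Lemma signs_dominating_diagonal (p : nat -> V -> R) y n :
  (forall j, seminorm (p j)) ->
  exists e, \sum_(j < n) p j (y j) <= \sum_(j < n) p j (signed_sum y e n).
Proof.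
move=> sp; elim: n => [|n [e IH]]; first by exists xpred0; rewrite !big_ord0.
pose s := signed_sum y e n.
pose e_ b k := if (k < n)%N then e k else b.
have sE b : signed_sum y (e_ b) n.+1 = s + (-1) ^+ b *: y n.
  rewrite /e_ /signed_sum big_ord_recr/= ltnn; congr (_ + _).
  by apply: eq_bigr => k _; rewrite ltn_ord.
pose P w := \sum_(j < n.+1) p j w.
suff : 2 * \sum_(j < n.+1) p j (y j) <= P (s + y n) + P (s - y n).
  have [le1|lt1] := leP (\sum_(j < n.+1) p j (y j)) (P (s + y n)) => le2.
    by exists (e_ false); rewrite sE expr0 scale1r.
  by exists (e_ true); rewrite sE expr1 scaleN1r -/(P _); lra.
rewrite /P !big_ord_recr/=.
have h1 : 2 * p n (y n) <= p n (s + y n) + p n (s - y n).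
  rewrite -[p n (s - _)](seminormN _ (sp n)) opprB addrC (addrC s) addrC.
  exact: seminorm_parallel.
have h2 : 2 * \sum_(j < n) p j s
    <= \sum_(j < n) p j (s + y n) + \sum_(j < n) p j (s - y n).
  exact: (seminorm_parallel s (y n) (seminorm_sum n sp)).
by move: IH; rewrite -/s; lra.
Qed.

(** With a signed sum w that dominates the diagonal, sum_(j < n) p_j(y_j) is at
most C N(w), where C comes from uniform boundedness on the unit ball of N, and
N(w) is bounded independently of n and of the signs. *)
Lemma diagonal_summable N (p : nat -> V -> R) y :
  seminorm N -> banach_disk [set x | N x <= 1] ->
  (forall j, seminorm (p j)) ->
  (forall j, exists c, forall x, N x <= 1 -> p j x <= c) ->
  (forall x, bounded_sums (p^~ x)) -> weakly_summable N y ->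
  bounded_sums (fun j => p j (y j)).
Proof.
move=> sN dN sp pb psum /(signed_sums_bounded sN)[M hM].
have [|||C hC] := @uniform_boundedness R V _ (fun n x => \sum_(j < n) p j x) dN.
- by move=> n; exact: seminorm_sum.
- move=> n; have /choice[c hc] := pb.
  by exists (\sum_(j < n) c j) => x Nx; apply: ler_sum => j _; exact: hc.
- by move=> x _; exact: psum.
have [B B0 MB] : exists2 B, 0 < B & M <= B.
  by exists (`|M| + 1); [rewrite ltr_wpDl|rewrite ler_wpDr// ler_norm].
exists (B * C) => n.
have [e he] := signs_dominating_diagonal y n sp; apply: le_trans he _.
rewrite -ler_pdivrMl//; set w := signed_sum y e n.
have := hC n (B^-1 *: w); rewrite (seminorm_sum n sp).2 gtr0_norm ?invr_gt0//.
apply; rewrite /= sN.2 gtr0_norm ?invr_gt0// ler_pdivrMl// mulr1.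
exact: le_trans (hM e n) MB.
Qed.

End WeaklySummable.

(** * Restriction of scalars to the reals *)

Section Realification.
Variables (R : realType) (s : scalars).
Local Notation K := (scalar_field R s).

(** A copy of V, so that its real module structure does not compete with the one
over the scalar field. *)
Definition realified (V : lmodType K) : Type := V.

Section Instances.
Variable V : lmodType K.
HB.instance Definition _ := GRing.Zmodule.on (realified V).
Definition real_scale (t : R) (x : realified V) : realified V :=
  of_real s t *: (x : V).
Fact real_scaleA a b x : real_scale a (real_scale b x) = real_scale (a * b) x.
Proof. by rewrite /real_scale scalerA -rmorphM. Qed.
Fact real_scale1 : left_id 1 real_scale.
Proof. by move=> x; rewrite /real_scale rmorph1 scale1r. Qed.
Fact real_scaleDr : right_distributive real_scale +%R.
Proof. by move=> t x y; exact: scalerDr. Qed.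
Fact real_scaleDl x : {morph real_scale^~ x : a b / a + b}.
Proof. by move=> a b; rewrite /real_scale rmorphD; exact: scalerDl. Qed.
HB.instance Definition _ := GRing.Zmodule_isLmodule.Build R (realified V)
  real_scaleA real_scale1 real_scaleDr real_scaleDl.
End Instances.

Lemma seminorm_rnorm (V : normedModType K) :
  seminorm (@rnorm R s V : realified V -> R).
Proof. by split; [exact: ler_rnormD|exact: rnormZ]. Qed.

Lemma rnorm_ball_disk (V : completeNormedModType K) :
  banach_disk [set x : realified V | @rnorm R s V x <= 1].
Proof.
split=> [x /= x1|u u1]; first by rewrite rnormN.
have [r [r1 rE]] := @geometric_tails R s V 1 u u1.
by exists r.
Qed.

Lemma lp1_bounded_sums (V : normedModType K) (x : nat -> V) :
  lp 1 V x <-> bounded_sums (fun j => rnorm (x j)).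
Proof.
have -> : lp 1 V x = (\sum_(0 <= j <oo) (rnorm (x j))%:E < +oo)%E :> Prop.
  rewrite /lp /=; congr (_ < _)%E; apply: eq_eseriesr => j _.
  by rewrite powRr1// rnorm_ge0.
have ge0 j : (0 <= (rnorm (x j))%:E)%E by rewrite lee_fin rnorm_ge0.
split=> [fin|[M hM]].
  exists (fine (\sum_(0 <= j <oo) (rnorm (x j))%:E)%E) => n.
  rewrite -lee_fin fineK; last by rewrite ge0_fin_numE// nneseries_ge0.
  rewrite -sumEFin -(big_mkord xpredT (fun j => (rnorm (x j))%:E)).
  exact: nneseries_lim_ge.
apply: (@le_lt_trans _ _ M%:E); last by rewrite ltry.
apply: lime_le; first exact: is_cvg_nneseries.
by apply: nearW => n; rewrite big_mkord sumEFin lee_fin.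
Qed.

End Realification.

Lemma linear_packed (K : numFieldType) (V W : lmodType K) (f : V -> W) :
  linear f -> exists phi : {linear V -> W}, phi =1 f.
Proof.
move=> lf; pose m := GRing.isLinear.Build _ _ _ _ f lf.
pose phi : {linear V -> W} := HB.pack f m.
by exists phi.
Qed.

(** Weak summability is tested by functionals over the scalar field.  A bounded real
functional u is dominated by one of them: u itself over the reals, and
x |-> u(x) - i u(ix), whose real part is u, over the complex numbers. *)
Lemma weak_l1_weakly_summable (R : realType) (s : scalars)
    (V : normedModType (scalar_field R s)) (y : nat -> V) :
  weak_lp 1 V y -> weakly_summable (@rnorm R s V : realified V -> R) y.
Proof.
move=> wy u du; have uN x := dual_ball_norm x (@seminorm_rnorm R s V) du.
case: du => lu _.
suff [phi [phib phiu]] : exists phi : {linear V -> (scalar_field R s)^o},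
    bounded_functional phi /\ forall x, `|u x| <= rnorm (phi x).
  have /lp1_bounded_sums[M hM] := wy phi phib.
  by exists M => n; apply: le_trans (hM n); apply: ler_sum => k _.
case: s V y wy u lu uN => [|] V y wy u lu uN.
  have /linear_packed[phi phiE] : linear (u : V -> R^o) by exact: lu.
  exists phi; split=> [|x]; last by rewrite phiE.
  by exists 1 => x; rewrite phiE mul1r; exact: uN.
pose i : complex R := 'i%C.
have uD x z : u (x + z) = u x + u z by have := lu 1 x z; rewrite !scale1r.
have u0 : u 0 = 0 by apply: (addrI (u 0)); rewrite addr0 -uD addr0.
have uZ (t : R) (x : V) : u (t%:C%C *: x) = t * u x.
  by have := lu t x 0; rewrite !addr0 u0 addr0.
pose f (x : V) : (complex R)^o := (u x +i* - u (i *: x))%C.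
have lf : linear f.
  move=> [a b] x z.
  have aE w : ((a +i* b)%C : complex R) *: w = a%:C%C *: w + b%:C%C *: (i *: w) :> V.
    rewrite scalerA -scalerDl; congr (_ *: _); rewrite /i.
    by apply/eqP; rewrite eq_complex /=; apply/andP; split; apply/eqP; ring.
  have iiE w : i *: (i *: w) = - w :> V.
    rewrite scalerA /i -scaleN1r; congr (_ *: _).
    by apply/eqP; rewrite eq_complex /=; apply/andP; split; apply/eqP; ring.
  have uN' w : u (- w) = - u w.
    by apply: (addrI (u w)); rewrite -uD !subrr.
  rewrite /f scalerDr !uD scalerA mulrC -scalerA !aE iiE !uD !uZ uN'.
  by apply/eqP; rewrite eq_complex /=; apply/andP; split; apply/eqP; ring.
have [phi phiE] := linear_packed lf.
have Re_le (z : complex R) : `|complex.Re z| <= complex.Re `|z|.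
  rewrite -lecR; apply: le_trans (normc_ge_Re z) _.
  by rewrite -[leLHS](real_partK (s := ComplexScalars)).
exists phi; split=> [|x]; last first.
  by rewrite phiE; exact: (Re_le (f x)).
have normi : `|i| = 1 :> complex R.
  by rewrite normc_def /= expr0n expr1n add0r sqrtr1.
have rnormi (x : V) : @rnorm R ComplexScalars V (i *: x) = rnorm x.
  by rewrite /rnorm normrZ normi mul1r.
exists 2 => x; rewrite phiE.
apply: le_trans (_ : `|u x| + `|u (i *: x)| <= _); last first.
  by rewrite mulr_natl mulr2n lerD ?uN// -(rnormi x) uN.
rewrite -[leLHS]/(complex.Re `|f x|) normc_def /= sqrrN.
rewrite -[leRHS]ger0_norm ?addr_ge0// -sqrtr_sqr ler_wsqrtr//.
rewrite -[u x ^+ 2]real_normK ?num_real// -[u (i *: x) ^+ 2]real_normK ?num_real//.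
by rewrite sqrrD -addrA [_ *+ 2 + _]addrC addrA lerDl mulrn_wge0// mulr_ge0.
Qed.

Lemma weakly_summable_diagonal (R : realType) (s : scalars)
    (V : completeNormedModType (scalar_field R s)) (p : nat -> V -> R)
    (y : nat -> V) :
  (forall j x z, p j (x + z) <= p j x + p j z) ->
  (forall j t x, p j (of_real s t *: x) = `|t| * p j x) ->
  (forall j, exists c, forall x, p j x <= c * rnorm x) ->
  (forall x, bounded_sums (p^~ x)) -> weak_lp 1 V y ->
  bounded_sums (fun j => p j (y j)).
Proof.
move=> pD pZ pb psum /weak_l1_weakly_summable wy.
apply: (@diagonal_summable R (realified V) _ p y (@seminorm_rnorm R s V)) => //.
- exact: rnorm_ball_disk.
- by move=> j; split; [exact: pD|exact: pZ].
move=> j; have [c hc] := pb j; exists `|c| => x x1.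
apply: le_trans (hc x) _; apply: le_trans (_ : `|c| * rnorm x <= _).
  by rewrite ler_wpM2r ?rnorm_ge0// ler_norm.
by rewrite -[leRHS]mulr1 ler_wpM2l.
Qed.

(** * Absorbing one variable of a multilinear map *)

Section AbsorbSlot.
Variables (R : realType) (s : scalars) (n : nat).
Local Notation K := (scalar_field R s).
Variables (E : 'I_n -> completeNormedModType K) (F : completeNormedModType K).
Variables (T : (forall i, E i) -> F) (x : forall i, nat -> E i).

Definition summable_up_to (t : nat) := forall g : forall i, E i,
  bounded_sums (fun j =>
    rnorm (T (fun i : 'I_n => if (i < t)%N then x i j else g i))).

(** With p_j(w) the norm of T at x_i(j) in the slots i < t, w in slot t and g_i
after it, the hypothesis for the frozen vectors g modified at t says that p_j(w)
is summable in j for every w, and the conclusion is that p_j(x_t(j)) is. *)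
Lemma summable_up_to_next (t : 'I_n) :
  bounded_multilinear E F T -> weak_lp 1 (E t) (x t) ->
  summable_up_to t -> summable_up_to t.+1.
Proof.
move=> [linT [C boundT]] wx sumt g.
pose z j (i : 'I_n) := if (i < t)%N then x i j else g i.
pose p j (w : E t) := rnorm (T (dfwith (z j) w)).
have [||||M hM] := @weakly_summable_diagonal R s (E t) p (x t) _ _ _ _ wx.
- move=> j u v; rewrite /p; have := linT t (z j) 1 u v.
  by rewrite !scale1r => ->; exact: ler_rnormD.
- move=> j c u; rewrite /p -rnormZ; congr rnorm.
  have T0 : T (dfwith (z j) (0 : E t)) = 0.
    have := linT t (z j) 1 0 0; rewrite !scale1r addr0 => h.
    by apply: (addrI (T (dfwith (z j) (0 : E t)))); rewrite addr0 -h.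
  by have := linT t (z j) (of_real s c) u 0; rewrite !addr0 T0 addr0.
- move=> j; exists (C * \prod_(i < n | i != t) rnorm (z j i)) => w.
  have prodE : \prod_(i < n) rnorm (dfwith (z j) w i) =
      \prod_(i < n | i != t) rnorm (z j i) * rnorm w.
    rewrite (bigD1 t)//= dfwith_in mulrC; congr (_ * _).
    by apply: eq_bigr => i it; rewrite dfwith_out// eq_sym.
  by rewrite -mulrA -prodE; exact: boundT.
- move=> w; apply: eq_bounded_sums (sumt (dfwith g w)) => j.
  rewrite /p; congr (rnorm (T _)).
  apply: functional_extensionality_dep => i.
  have [<-|ti] := eqVneq t i; first by rewrite !dfwith_in ltnn.
  by rewrite !dfwith_out.
have sums_p : bounded_sums (fun j => p j (x t j)) by exists M.
apply: eq_bounded_sums sums_p => j; rewrite /p; congr (rnorm (T _)).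
apply: functional_extensionality_dep => i.
have [<-|ti] := eqVneq t i; first by rewrite dfwith_in ltnSn.
rewrite dfwith_out// /z.
have -> // : (i < t.+1)%N = (i < t)%N.
by rewrite ltnS leq_eqVlt eq_sym (negbTE ti : (t == i :> nat) = false).
Qed.

End AbsorbSlot.

(** * Splitting the index set of a family of spaces *)

(** A family over I with values in P composed with sigma is moved to S by
transport along the equations tau provides; transporting back is trivial because
equality proofs in S are unique. *)
Lemma dependent_reindex (I S : eqType) (sigma : I -> S) (tau : S -> I)
    (P : S -> Type) (x : forall i, P (sigma i)) :
  cancel sigma tau -> cancel tau sigma ->
  exists x' : forall s, P s, forall i, x' (sigma i) = x i.
Proof.
move=> sK tK; exists (fun s => eq_rect _ P (x (tau s)) s (tK s)) => i.
move: (tK (sigma i)); move: (tau (sigma i)) (sK i) => i' ->{i'} e.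
by rewrite (eq_irrelevance e (erefl _)).
Qed.

Section Append.
Variables (m n : nat) (le_mn : (m <= n)%N).

(** [append] is [side_cases] at this image of the index, by conversion.  Proofs
about a family over the appended index set therefore move to the sum, where the
spaces are E and G themselves, and no other cast is needed. *)
Definition index_split (i : 'I_n) : 'I_m + 'I_(n - m) :=
  fintype.split (cast_ord (esym (subnKC le_mn)) i).

Definition index_unsplit (s : 'I_m + 'I_(n - m)) : 'I_n :=
  cast_ord (subnKC le_mn) (unsplit s).

Lemma index_splitK : cancel index_split index_unsplit.
Proof. by move=> i; rewrite /index_split /index_unsplit splitK cast_ordKV. Qed.

Lemma index_unsplitK : cancel index_unsplit index_split.
Proof. by move=> i; rewrite /index_split /index_unsplit cast_ordK unsplitK. Qed.

Lemma index_split_ltn (i : 'I_n) :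
  (i < m)%N = (if index_split i is inl _ then true else false).
Proof.
rewrite /index_split; case: splitP => [j /= ->|k /= ->]; first by rewrite ltn_ord.
by rewrite ltnNge leq_addr.
Qed.

Definition side_cases (A : Type) (a : 'I_m -> A) (b : 'I_(n - m) -> A) s :=
  match s with inl j => a j | inr k => b k end.

Variables (R : realType) (s : scalars).
Local Notation K := (scalar_field R s).
Variables (E : 'I_m -> completeNormedModType K)
  (G : 'I_(n - m) -> completeNormedModType K) (F : completeNormedModType K).

Definition glue (a : forall j, E j) (b : forall k, G k) s : side_cases E G s :=
  match s with inl j => a j | inr k => b k end.

(** Multilinearity in one variable, read over the sum: for t of the form
[index_split i] it is multilinearity of T in variable i, and every t is of this
form. *)
Lemma multilinear_split (T : (forall i, append le_mn E G i) -> F)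
    (z : forall t, side_cases E G t) (t : 'I_m + 'I_(n - m)) :
  multilinear (append le_mn E G) F T ->
  linear (fun u : side_cases E G t => T (fun i => dfwith z u (index_split i))).
Proof.
move=> linT; move: t.
suff H i : linear (fun u : side_cases E G (index_split i) =>
    T (fun i' => dfwith z u (index_split i'))).
  by move=> t; rewrite -(index_unsplitK t); exact: H.
move=> c u v.
have dE w : (fun i' => dfwith z (i := index_split i) w (index_split i')) =
    dfwith (T := fun i => append le_mn E G i) (fun i' => z (index_split i'))
      (i := i) w.
  apply: functional_extensionality_dep => i'.
  have [<-|ii'] := eqVneq i i'; first by rewrite !dfwith_in.
  by rewrite !dfwith_out// (can_eq index_splitK).
rewrite !dE; exact: linT.
Qed.

Lemma bounded_multilinear_glue (T : (forall i, append le_mn E G i) -> F) b :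
  bounded_multilinear (append le_mn E G) F T ->
  bounded_multilinear E F (fun a => T (fun i => glue a b (index_split i))).
Proof.
move=> [linT [C boundT]]; split=> [j a|].
  have dE (u : E j) : (fun i => glue (dfwith a u) b (index_split i)) =
      (fun i => dfwith (glue a b) (i := inl j) u (index_split i)).
    apply: functional_extensionality_dep => i.
    case: (index_split i) => [j'|k] /=; last by rewrite dfwith_out.
    have [<-|jj'] := eqVneq j j'; first by rewrite !dfwith_in.
    by rewrite !dfwith_out.
  move=> c u v; rewrite !dE.
  exact: (@multilinear_split T (glue a b) (inl j) linT c u v).
exists (C * \prod_(k < n - m) rnorm (b k)) => a.
have prodE : \prod_(i < n) rnorm (glue a b (index_split i)) =
    \prod_(k < n - m) rnorm (b k) * \prod_(j < m) rnorm (a j).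
  transitivity (\prod_(t : 'I_m + 'I_(n - m)) rnorm (glue a b t)).
    rewrite (reindex index_split)//.
    by exists index_unsplit => ? _; [exact: index_splitK|exact: index_unsplitK].
  by rewrite big_sumType mulrC.
by rewrite -mulrA -prodE; exact: boundT.
Qed.

Lemma summable_up_to_start (q : 'I_m -> R) (q' : 'I_(n - m) -> R)
    (T : (forall i, append le_mn E G i) -> F)
    (x : forall i, nat -> append le_mn E G i) :
  bounded_multilinear E F = absolutely_summing E F 1 q ->
  bounded_multilinear (append le_mn E G) F T ->
  (forall i, weak_lp (append le_mn q q' i) (append le_mn E G i) (x i)) ->
  summable_up_to T x m.
Proof.
move=> allsum bT wx g.
have [x' x'E] := @dependent_reindex _ _ index_split index_unsplit
  (fun t => nat -> side_cases E G t) x index_splitK index_unsplitK.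
have [g' g'E] := @dependent_reindex _ _ index_split index_unsplit
  (fun t => side_cases E G t) g index_splitK index_unsplitK.
have wx' t : weak_lp (side_cases q q' t) (side_cases E G t) (x' t).
  have H i : weak_lp (side_cases q q' (index_split i))
      (side_cases E G (index_split i)) (x' (index_split i)) by rewrite x'E; exact: wx.
  by rewrite -(index_unsplitK t); exact: H.
have := bounded_multilinear_glue (fun k => g' (inr k)) bT; rewrite allsum.
case=> _ /(_ (fun j => x' (inl j)) (fun j => wx' (inl j)))/lp1_bounded_sums.
apply: eq_bounded_sums => j; congr (rnorm (T _)).
apply: functional_extensionality_dep => i.
have glueE t : (if (if t is inl _ then true else false) then x' t j else g' t)
    = glue (fun i => x' (inl i) j) (fun k => g' (inr k)) t by case: t.
by rewrite -x'E -g'E index_split_ltn; exact: esym (glueE _).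
Qed.

End Append.

(** * Extending the coincidence to more variables *)

Theorem corollary3 (R : realType) (s : scalars) (m n : nat)
    (m_ge1 : (1 <= m)%N) (le_mn : (m <= n)%N)
    (E : 'I_m -> completeNormedModType (scalar_field R s))
    (F : completeNormedModType (scalar_field R s))
    (q : 'I_m -> R) (q_ge1 : forall i, 1 <= q i) :
  bounded_multilinear E F = absolutely_summing E F 1 q ->
  forall G : 'I_(n - m) -> completeNormedModType (scalar_field R s),
    bounded_multilinear (append le_mn E G) F
    = absolutely_summing (append le_mn E G) F 1 (append le_mn q (fun=> 1)).
Proof.
move=> allsum G; apply/seteqP; split=> [T bT|T []//]; split=> // x wx.
suff sum_d d : (m + d <= n)%N -> summable_up_to T x (m + d).
  apply/lp1_bounded_sums.
  (* At t = n no slot is frozen, and the frozen vectors are arbitrary. *)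
  apply: eq_bounded_sums (sum_d (n - m)%N (eq_leq (subnKC le_mn)) (x^~ 0%N)) => j.
  congr (rnorm (T _)); apply: functional_extensionality_dep => i.
  by rewrite subnKC// ltn_ord.
elim: d => [|d IH] lt_mdn.
  by rewrite addn0; exact: summable_up_to_start allsum bT wx.
rewrite addnS in lt_mdn *.
apply: (@summable_up_to_next _ _ _ _ _ _ _ (Ordinal lt_mdn)) => //; last first.
  exact: IH (ltnW lt_mdn).
have := wx (Ordinal lt_mdn).
suff -> : append le_mn q (fun=> 1) (Ordinal lt_mdn) = 1 by [].
have := index_split_ltn le_mn (Ordinal lt_mdn).
rewrite /= ltnNge leq_addr /append -/(index_split le_mn _).
by case: index_split.
Qed.
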